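(* For any join-semidistributive lattices $A$ and $B$, the box product $A\mathbin{\square}B$ is join-semidistributive.
   Context: A lattice $L$ is join-semidistributive if $x\vee y=x\vee z$ implies $x\vee y=x\vee(y\wedge z)$ for all $x,y,z\in L$. For arbitrary lattices $A$ and $B$ and $(a,b)\in A\times B$, put $a\mathbin{\square}b=\{(x,y)\in A\times B\mid x\le a\text{ or }y\le b\}$. The box product $A\mathbin{\square}B$ is the set of all intersections $\bigcap_{i<n}(a_i\mathbin{\square}b_i)$ with $n$ a positive integer and $(a_i,b_i)\in A\times B$ for $i<n$, partially ordered by inclusion; it is a lattice (Grätzer and Wehrung). *)

(* Defs.v *)
From HB Require Import structures.
From mathcomp Require Import all_boot all_order.
From mathcomp Require Import boolp classical_sets.

Set Implicit Arguments.
Unset Strict Implicit.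
Unset Printing Implicit Defensive.

Import Order.LTheory.
Local Open Scope classical_set_scope.
Local Open Scope order_scope.

Definition join_semidistributive d (L : latticeType d) : Prop :=
  forall x y z : L,
    x `|` y = x `|` z :> L -> x `|` y = x `|` (y `&` z) :> L.

Fact box_product_display (_ _ : Order.disp_t) : Order.disp_t.
Proof. exact: Order.Disp tt tt. Qed.

Section BoxProduct.
Context {dA dB : Order.disp_t} (A : latticeType dA) (B : latticeType dB).

Definition box (a : A) (b : B) : set (A * B) :=
  [set p | p.1 <= a \/ p.2 <= b].

Definition box_sets : set (set (A * B)) :=
  [set H | exists (n : nat) (a : 'I_n -> A) (b : 'I_n -> B),
    (0 < n)%N /\ H = \bigcap_(i in [set: 'I_n]) box (a i) (b i)].

Record box_product : Type := BoxProduct {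
  box_product_val :> set (A * B);
  _ : box_product_val \in box_sets }.

HB.instance Definition _ := [isSub for box_product_val].
HB.instance Definition _ := [Choice of box_product by <:].

(* The base order, on set (A * B), is inclusion. *)
HB.instance Definition _ :=
  [SubChoice_isSubPOrder of box_product by <: with box_product_display dA dB].

Lemma box_product_leP (H K : box_product) :
  reflect (box_product_val H `<=` box_product_val K)%classic (H <= K).
Proof. by rewrite -Order.le_val; apply: (iffP idP) => /subsetPset. Qed.

Lemma box_productP (H : box_product) : box_sets (box_product_val H).
Proof. by case: H => H /= /set_mem. Qed.

Lemma box_sets_fin (I : finType) (a : I -> A) (b : I -> B) (i0 : I) :
  box_sets (\bigcap_(i in [set: I]) box (a i) (b i)).
Proof.
exists #|I|, (a \o enum_val), (b \o enum_val); split.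
  by apply/card_gt0P; exists i0.
apply/seteqP; split=> p Hp i _ /=; first exact: (Hp (enum_val i)).
by have := Hp (enum_rank i) Logic.I; rewrite /= enum_rankK.
Qed.

Lemma box_setsI (H K : set (A * B)) :
  box_sets H -> box_sets K -> box_sets (H `&` K)%classic.
Proof.
move=> [n [a [b [n0 ->]]]] [m [c [d [m0 ->]]]].
pose f i := match i with inl i => a i | inr j => c j end.
pose g i := match i with inl i => b i | inr j => d j end.
suff -> : (\bigcap_(i in [set: 'I_n]) box (a i) (b i) `&`
           \bigcap_(i in [set: 'I_m]) box (c i) (d i))%classic =
          \bigcap_(i in [set: 'I_n + 'I_m]) box (f i) (g i).
  exact: (@box_sets_fin _ f g (inl (Ordinal n0))).
apply/seteqP; split=> p.
  by move=> [Ha Hc] [i|j] _; [exact: Ha|exact: Hc].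
by move=> Hp; split=> i _; [exact: (Hp (inl i))|exact: (Hp (inr i))].
Qed.

Definition box_meet (H K : box_product) : box_product :=
  BoxProduct (mem_set (box_setsI (box_productP H) (box_productP K))).

Lemma box_meetP (H K L : box_product) :
  (H <= box_meet K L) = (H <= K) && (H <= L).
Proof.
apply/box_product_leP/andP => [HKL|[/box_product_leP HK /box_product_leP HL]].
  by split; apply/box_product_leP => p /HKL [].
by move=> p Hp; split; [exact: HK|exact: HL].
Qed.

End BoxProduct.

(* The intersection of the boxes box (a i) (b i) is the union, over the sets X
   of indices, of the rectangles of the (x, y) such that x <= a i for all i in
   X and y <= b i for all i not in X. Lattices need not be bounded, so None
   stands for the bound of an empty family: a top element in omeet and below, a
   bottom element in ojoin and above. The join of two members of the box product
   is obtained from the rectangles of both, one box for each way of distributing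
   the rectangles between the two coordinates. *)
Section OptionBounds.
Context {d : Order.disp_t} (L : latticeType d).
Implicit Types (u v : option L) (x : L).

Definition omeet u v :=
  match u, v with
  | Some x, Some y => Some (x `&` y)
  | None, _ => v
  | _, None => u
  end.

Definition ojoin u v :=
  match u, v with
  | Some x, Some y => Some (x `|` y)
  | None, _ => v
  | _, None => u
  end.

Definition below x u : bool := if u is Some y then x <= y else true.
Definition above x u : bool := if u is Some y then y <= x else true.

Lemma below_big (I : finType) (X : {set I}) (f : I -> L) x :
  below x (\big[omeet/None]_(i in X) Some (f i)) = [forall i in X, x <= f i].
Proof.
rewrite (big_morph (below x) (op1 := andb) (id1 := true)) //= ?big_andE //.
by move=> [y|] [z|] //=; rewrite ?lexI ?andbT.
Qed.

Lemma above_big (I : finType) (X : {set I}) (f : I -> option L) x :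
  above x (\big[ojoin/None]_(i in X) f i) = [forall i in X, above x (f i)].
Proof.
rewrite (big_morph (above x) (op1 := andb) (id1 := true)) //= ?big_andE //.
by move=> [y|] [z|] //=; rewrite ?leUx ?andbT.
Qed.

Lemma isSome_omeet (I : finType) (X : {set I}) (f : I -> L) :
  isSome (\big[omeet/None]_(i in X) Some (f i)) = (X != finset.set0).
Proof.
rewrite (big_morph isSome (op1 := orb) (id1 := false)) //=; last by case=> [?|] [?|].
rewrite big_orE; apply/existsP/set0Pn => -[i]; first by rewrite andbT; exists i.
by move=> Xi; exists i; rewrite Xi.
Qed.

Lemma isSome_ojoin (I : finType) (X : {set I}) (f : I -> option L) :
  isSome (\big[ojoin/None]_(i in X) f i) = [exists i in X, isSome (f i)].
Proof.
rewrite (big_morph isSome (op1 := orb) (id1 := false)) ?big_orE //.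
by case=> [?|] [?|].
Qed.

End OptionBounds.

Section BoxJoin.
Context {dA dB : Order.disp_t} (A : latticeType dA) (B : latticeType dB).

Definition rectangles (T : finType) (f : T -> option A) (g : T -> option B) :
    set (A * B) :=
  [set p | exists t, below p.1 (f t) /\ below p.2 (g t)].

Lemma bigcap_box_rectangles n (a : 'I_n -> A) (b : 'I_n -> B) :
  \bigcap_(i in [set: 'I_n]) box (a i) (b i) =
  rectangles (fun X : {set 'I_n} => \big[@omeet _ A/None]_(i in X) Some (a i))
             (fun X => \big[@omeet _ B/None]_(i in ~: X) Some (b i)).
Proof.
apply/seteqP; split=> [[x y] Hxy|[x y] [X]] /=.
  exists [set i | x <= a i]%SET; rewrite !below_big; split.
    by apply/forall_inP => i; rewrite inE.
  by apply/forall_inP => i; rewrite !inE; case: (Hxy i Logic.I) => [/= ->|].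
rewrite !below_big => -[/forall_inP Hx /forall_inP Hy] i _.
have [iX|iX] := boolP (i \in X); first by left; apply: Hx.
by right; apply: Hy; rewrite inE.
Qed.

Lemma rectangles_lub (T : finType) (f : T -> option A) (g : T -> option B)
    (t0 : T) (t1 : T) :
  (forall t, isSome (f t) || isSome (g t)) ->
  g t0 = None -> f t1 = None ->
  exists2 J, box_sets J &
    forall K, box_sets K -> (J `<=` K <-> rectangles f g `<=` K)%classic.
Proof.
move=> fg gt0 ft1.
pose adm (S : {set T}) :=
  [forall t in S, isSome (f t)] && [forall t in ~: S, isSome (g t)].
pose ca (S : {set T}) := \big[@ojoin _ A/None]_(t in S) f t.
pose cb (S : {set T}) := \big[@ojoin _ B/None]_(t in ~: S) g t.
have admP S : adm S -> exists a b, ca S = Some a /\ cb S = Some b.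
  move=> /andP[/forall_inP Sf /forall_inP Sg].
  have [a caS] : exists a, ca S = Some a.
    suff : isSome (ca S) by case: (ca S) => // a; exists a.
    rewrite isSome_ojoin; apply/exists_inP; exists t0.
      by apply/negPn/negP => t0S; have := Sg t0; rewrite inE gt0 t0S => /(_ isT).
    by have := fg t0; rewrite gt0 orbF.
  have [b cbS] : exists b, cb S = Some b.
    suff : isSome (cb S) by case: (cb S) => // b; exists b.
    rewrite isSome_ojoin; apply/exists_inP; exists t1.
      by rewrite inE; apply/negP => /Sf; rewrite ft1.
    by have := fg t1; rewrite ft1.
  by exists a, b.
have adm0 : adm [set t | isSome (f t)]%SET.
  apply/andP; split; apply/forall_inP => t; rewrite !inE //.
  by move/negbTE => ftN; have := fg t; rewrite ftN.
have [a0 _] := admP _ adm0.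
have [_ [b0 _]] := admP _ adm0.
pose U : finType := {S : {set T} | adm S}.
pose a (S : U) := odflt a0 (ca (val S)).
pose b (S : U) := odflt b0 (cb (val S)).
exists (\bigcap_(S in [set: U]) box (a S) (b S)).
  pose S0 : U := exist (fun S : {set T} => adm S) _ adm0.
  exact: (box_sets_fin a b S0).
move=> _ [n [c [d [_ ->]]]]; split; last first.
  move=> UK [x y] Hxy i _ /=.
  pose S := [set t | `[< forall x', below x' (f t) -> x' <= c i >]]%SET.
  have inS t x' : t \in S -> below x' (f t) -> x' <= c i.
    by rewrite inE => /asboolP; apply.
  have notinS t y' : t \notin S -> below y' (g t) -> y' <= d i.
    rewrite inE => /asboolP/existsNP[x' /not_implyP[xf xc]] yg.
    have [] // : box (c i) (d i) (x', y').
    by apply: UK => //; exists t.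
  have [admS|] := boolP (adm S); last first.
    rewrite negb_and !negb_forall_in => /orP[] /exists_inP[t tS].
      by case ft: (f t) => // _; left; apply: (inS t) => //; rewrite ft.
    rewrite inE in tS.
    by case gt: (g t) => // _; right; apply: (notinS t) => //; rewrite gt.
  have := Hxy (exist (fun S : {set T} => adm S) S admS) Logic.I; rewrite /a /b /=.
  have [a' [b' [ca' cb']]] := admP _ admS; rewrite ca' cb' /=.
  case=> [xa|yb]; [left; apply: le_trans xa _|right; apply: le_trans yb _].
    have : above (c i) (ca S).
      rewrite above_big; apply/forall_inP => t /inS.
      by case: (f t) => //= z; apply.
    by rewrite ca'.
  have : above (d i) (cb S).
    rewrite above_big; apply/forall_inP => t; rewrite inE => /notinS.
    by case: (g t) => //= z; apply.
  by rewrite cb'.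
move=> JK p [t [pf pg]]; apply: JK => -[S admS] _; rewrite /a /b /=.
have [a' [b' [ca' cb']]] := admP _ admS; rewrite ca' cb' /=.
have : above a' (ca S) by rewrite ca' /=.
have : above b' (cb S) by rewrite cb' /=.
rewrite !above_big => /forall_inP Hb /forall_inP Ha.
move: (admS) => /andP[/forall_inP Sf /forall_inP Sg].
have [tS|tS] := boolP (t \in S); [left|right].
  have := Sf t tS; have := Ha t tS; move: pf.
  by case: (f t) => //= z pz za _; apply: le_trans za.
have {}tS : t \in ~: S by rewrite inE.
have := Sg t tS; have := Hb t tS; move: pg.
by case: (g t) => //= z pz zb _; apply: le_trans zb.
Qed.

Lemma box_lub (H K : box_product A B) :
  {J : box_product A B | forall L, (J <= L) = (H <= L) && (K <= L)}.
Proof.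
apply: cid.
have [n [a [b [n0 Hab]]]] := box_productP H.
have [m [a' [b' [m0 Kab]]]] := box_productP K.
rewrite !bigcap_box_rectangles in Hab Kab.
move: Hab Kab; set f := (fun X => _); set g := (fun X => _).
set f' := (fun X => _); set g' := (fun X => _) => Hfg Kfg.
pose F (t : {set 'I_n} + {set 'I_m}) :=
  match t with inl X => f X | inr X => f' X end.
pose G (t : {set 'I_n} + {set 'I_m}) :=
  match t with inl X => g X | inr X => g' X end.
have nT : (finset.setT : {set 'I_n}) != finset.set0.
  by apply/set0Pn; exists (Ordinal n0); rewrite inE.
have mT : (finset.setT : {set 'I_m}) != finset.set0.
  by apply/set0Pn; exists (Ordinal m0); rewrite inE.
have [||| J JB JP] := @rectangles_lub _ F G (inl finset.setT) (inl finset.set0).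
- case=> X /=; rewrite !isSome_omeet; case: eqP => // ->.
    by rewrite finset.setC0.
  by rewrite finset.setC0.
- by rewrite /= /g finset.setCT big_set0.
- by rewrite /= /f big_set0.
exists (BoxProduct (mem_set JB)) => L.
apply/box_product_leP/andP.
  move=> /(JP _ (box_productP L)) FGL.
  split; apply/box_product_leP; rewrite ?Hfg ?Kfg => p [t pt]; apply: FGL.
    by exists (inl t).
  by exists (inr t).
move=> [/box_product_leP HL /box_product_leP KL].
apply/(JP _ (box_productP L)) => p [[t|t] pt].
  by apply: HL; rewrite Hfg; exists t.
by apply: KL; rewrite Kfg; exists t.
Qed.

Definition box_join (H K : box_product A B) : box_product A B :=
  sval (box_lub H K).

Lemma box_joinP (H K L : box_product A B) :
  (box_join H K <= L) = (H <= L) && (K <= L).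
Proof. exact: (svalP (box_lub H K)). Qed.

HB.instance Definition _ :=
  Order.POrder_MeetJoin_isLattice.Build _ (box_product A B)
    (@box_meetP _ _ A B) box_joinP.

End BoxJoin.

(* Main.v *)
(** Every member of the box product is an intersection of boxes, so it suffices
    to show that [Y] lies in each box [a □ b] containing [X] and [Y ∩ Z]. Every
    larger box [a' □ b'] contains [X], so [X ∨ Y = X ∨ Z] says that it contains
    [Y] if and only if it contains [Z]. Replace [Y] and [Z] by finite sets of
    points [P] and [Q] detecting this. If [P] is not contained in [a □ b],
    enlarge [b] until [P] lies in [a □ (b ∨ s)] for all points [(r, s)] of [P]
    and [Q] with [s ≰ b]. The points of [P] and [Q] outside [a □ b] then all
    have the same join [b ∨ s], and by semidistributivity of [B] the meet [y] of
    these [s] is still not below [b]. If [x] and [z] are the joins of the first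
    coordinates of those points, taken over [P] and over [Q], then
    [(x, y)] is in [Y], [(z, y)] is in [Z] and [a ∨ x = a ∨ z ≠ a], so
    semidistributivity of [A] puts [(x ∧ z, y)] in [Y ∩ Z] outside [a □ b]. *)
Require Import Defs.
From mathcomp Require Import all_boot all_order.
From mathcomp Require Import boolp classical_sets.

Set Implicit Arguments.
Unset Strict Implicit.
Unset Printing Implicit Defensive.

Import Order.LTheory.
Local Open Scope order_scope.

Lemma ltn_count (T : eqType) (p q : pred T) (s : seq T) (t : T) :
  (forall u, p u -> q u) -> t \in s -> q t -> ~~ p t -> (count p s < count q s)%N.
Proof.
move=> pq ts qt pt.
have -> : count p s = count p (filter q s).
  by rewrite count_filter; apply: eq_count => u /=; case: (boolP (p u)) => // /pq.
rewrite -(size_filter q) ltn_neqAle count_size andbT -all_count.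
by apply/allPn; exists t; rewrite // mem_filter qt.
Qed.

(** * Finite joins and meets *)

Section Folds.
Context {d : Order.disp_t} {L : latticeType d} {T : eqType}.
Implicit Types (f : T -> L) (s : seq T) (x y : L) (t : T).

Definition joins f x s : L := foldr (fun t y => f t `|` y) x s.
Definition meets f x s : L := foldr (fun t y => f t `&` y) x s.

Lemma joins_ge f x s t : t \in s -> f t <= joins f x s.
Proof.
elim: s => //= u s IHs; rewrite inE => /predU1P[->|/IHs ft]; first exact: leUl.
exact: le_trans ft (leUr _ _).
Qed.

Lemma joins_le f x s y :
  x <= y -> (forall t, t \in s -> f t <= y) -> joins f x s <= y.
Proof.
move=> xy; elim: s => //= t s IHs fy; rewrite leUx fy ?mem_head //=.
by apply: IHs => u us; apply: fy; rewrite inE us orbT.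
Qed.

Lemma meets_le f x s t : t \in s -> meets f x s <= f t.
Proof.
elim: s => //= u s IHs; rewrite inE => /predU1P[->|/IHs ft]; first exact: leIl.
exact: le_trans (leIr _ _) ft.
Qed.

(** Semidistributivity is used once per list element: [f t] and the meet of the remaining terms have
    the same join with [y], so their meet has that join too. *)
Lemma join_meets (hL : join_semidistributive L) f x s y :
  (forall t, t \in s -> y `|` f t = y `|` x) -> y `|` meets f x s = y `|` x.
Proof.
elim: s => //= t s IHs fx; rewrite -hL; first by rewrite fx ?mem_head.
by rewrite fx ?mem_head // IHs // => u us; apply: fx; rewrite inE us orbT.
Qed.

End Folds.

(** * Points of box sets and detection by finite sets *)

Section BoxSets.
Context {dA dB : Order.disp_t} {A : latticeType dA} {B : latticeType dB}.
Implicit Types (a x : A) (b y : B) (H Y Z : set (A * B)) (P Q : seq (A * B)).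

Lemma box_sets_le H x y x' y' :
  box_sets H -> H (x, y) -> x' <= x -> y' <= y -> H (x', y').
Proof.
move=> [n [a [b [_ ->]]]] Hxy xx yy i _.
by case: (Hxy i Logic.I) => /= [xa|yb]; [left; exact: le_trans xa
                                        |right; exact: le_trans yb].
Qed.

(** In each box, either [y] is below the second side, or both first coordinates, hence their join,
    are below the first side. *)
Lemma box_setsU H x x' y :
  box_sets H -> H (x, y) -> H (x', y) -> H (x `|` x', y).
Proof.
move=> [n [a [b [_ ->]]]] Hx Hx' i _.
case: (Hx i Logic.I) => /= [xa|yb]; last by right.
case: (Hx' i Logic.I) => /= [xa'|yb]; last by right.
by left; rewrite /= leUx xa.
Qed.

Lemma box_sets_joins H x y P :
  box_sets H -> H (x, y) -> (forall p, p \in P -> H p /\ y <= p.2) ->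
  H (joins fst x P, y).
Proof.
move=> HB Hxy; elim: P => //= -[x' y'] P IHP HP; apply: box_setsU => //.
  by have [Hp yp] := HP _ (mem_head _ _); apply: box_sets_le Hp _ yp.
by apply: IHP => p pP; apply: HP; rewrite inE pP orbT.
Qed.

Definition inbox a b (p : A * B) : bool := (p.1 <= a) || (p.2 <= b).

Lemma inboxP a b p : reflect (box a b p) (inbox a b p).
Proof. exact: orP. Qed.

Lemma inbox_le a b a' b' p :
  a <= a' -> b <= b' -> inbox a b p -> inbox a' b' p.
Proof.
move=> aa bb /orP[pa|pb]; apply/orP.
  by left; apply: le_trans aa.
by right; apply: le_trans bb.
Qed.

(* A rectangle unbounded in one direction is represented by its corner at a
   large enough u or v. *)
Lemma box_sets_finite_test H : box_sets H ->
  exists u0 v0, forall u v, u0 <= u -> v0 <= v -> exists P,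
    [/\ forall p, p \in P -> [/\ H p, p.1 <= u & p.2 <= v] &
        forall a b, ~~ (u <= a) -> ~~ (v <= b) ->
          all (inbox a b) P -> (H `<=` box a b)%classic].
Proof.
move=> [n [a0 [b0 [n0 ->]]]]; pose i0 := Ordinal n0.
exists (joins a0 (a0 i0) (enum 'I_n)), (joins b0 (b0 i0) (enum 'I_n)).
move=> u v u0u v0v.
have au i : a0 i <= u by apply: le_trans u0u; rewrite joins_ge ?mem_enum.
have bv i : b0 i <= v by apply: le_trans v0v; rewrite joins_ge ?mem_enum.
rewrite bigcap_box_rectangles.
pose f (X : {set 'I_n}) := \big[@omeet _ A/None]_(i in X) Some (a0 i).
pose g (X : {set 'I_n}) := \big[@omeet _ B/None]_(i in ~: X) Some (b0 i).
rewrite -/f -/g.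
have corner (d : Order.disp_t) (L : latticeType d) (X : {set 'I_n})
    (h : 'I_n -> L) w : (forall i, h i <= w) ->
    let c := odflt w (\big[@omeet _ L/None]_(i in X) Some (h i)) in
    below c (\big[@omeet _ L/None]_(i in X) Some (h i)) /\ c <= w.
  move=> hw c; set m := \big[_/_]_(_ in _) _.
  have cm : below c m by rewrite /c -/m; case: m => /=.
  split=> //; have [X0|[i iX]] := set_0Vmem X; first by rewrite /c X0 big_set0.
  by apply: le_trans (hw i); move: cm; rewrite below_big => /forall_inP/(_ i iX).
exists [seq (odflt u (f X), odflt v (g X)) | X : {set 'I_n}]; split.
  move=> _ /mapP[X _ ->] /=.
  have [fX fu] := corner _ _ X a0 u au.
  have [gX gv] := corner _ _ (~: X)%SET b0 v bv.
  by split=> //; exists X.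
move=> a b ua vb /allP Pab [x y] [X [/= xf yg]].
have /orP := Pab _ (map_f _ (mem_enum _ X)).
case=> /=.
  case: (f X) xf => [z|] /= xz; last by rewrite (negbTE ua).
  by move=> za; left; apply: le_trans za.
case: (g X) yg => [z|] /= yz; last by rewrite (negbTE vb).
by move=> zb; right; apply: le_trans zb.
Qed.

Lemma box_sets_finite_core (hA : join_semidistributive A)
    (hB : join_semidistributive B) Y Z P Q a b :
  box_sets Y -> box_sets Z ->
  (forall p, p \in P -> Y p) -> (forall q, q \in Q -> Z q) ->
  (forall a' b', a <= a' -> b <= b' ->
     all (inbox a' b') P = all (inbox a' b') Q) ->
  (Y `&` Z `<=` box a b)%classic ->
  all (inbox a b) P.
Proof.
(* Induction on the number of points whose second coordinate is not below [b]; replacing [b] by its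
   join with [r.2] stops counting [r]. *)
move=> YB ZB PY QZ; have [n] := ubnP (count (fun r => ~~ (r.2 <= b)) (P ++ Q)).
elim: n b => // n IHn b; rewrite ltnS => cntn PQ YZ.
have step r : r \in P ++ Q -> ~~ (r.2 <= b) ->
    all (inbox a (b `|` r.2)) P /\ all (inbox a (b `|` r.2)) Q.
  move=> rPQ rb; rewrite -PQ ?leUl //; suff inP : all (inbox a (b `|` r.2)) P by [].
  apply: IHn.
  - apply: leq_trans cntn.
    apply: (ltn_count (t := r)) => //=; last by rewrite leUr.
    by move=> t; apply: contra => tb; apply: le_trans tb (leUl _ _).
  - by move=> a' b' aa; rewrite leUx => /andP[bb _]; apply: PQ.
  - by move=> p /YZ/inboxP pab; apply/inboxP; apply: inbox_le pab; rewrite ?leUl.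
apply: contraT => /allPn[p0 p0P p0ab].
have /allPn[q0 q0Q q0ab] : ~~ all (inbox a b) Q.
  by rewrite -PQ //; apply/allPn; exists p0.
pose out := predC (inbox a b).
pose P' := filter out P; pose Q' := filter out Q.
have p0P' : p0 \in P' by rewrite mem_filter p0P andbT.
have q0Q' : q0 \in Q' by rewrite mem_filter q0Q andbT.
(* Since [s.1] is not below [a], the membership of [s] in the enlarged box given by [step] must come
   from its second coordinate. By symmetry all outside points have the same join with [b]. *)
have le2 r s : r \in P' ++ Q' -> s \in P' ++ Q' -> s.2 <= b `|` r.2.
  rewrite -filter_cat !mem_filter => /andP[/norP[_ rb] rPQ].
  move=> /andP[/norP[sa _] sPQ].
  have [/allP stP /allP stQ] := step r rPQ rb.
  have /orP[] // : inbox a (b `|` r.2) s; last by rewrite (negbTE sa).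
  by move: sPQ; rewrite mem_cat => /orP[/stP|/stQ].
pose y := meets snd p0.2 (P' ++ Q').
have yE : b `|` y = b `|` p0.2.
  have p0PQ : p0 \in P' ++ Q' by rewrite mem_cat p0P'.
  by apply: join_meets => // r rPQ; apply/le_anti; rewrite !leUx !leUl !le2.
have yNb : ~~ (y <= b).
  apply: contra p0ab => yb; apply/orP; right.
  by move: yE; rewrite (join_idPl yb) => ->; rewrite leUr.
pose x := joins fst p0.1 P'; pose z := joins fst q0.1 Q'.
have Yxy : Y (x, y).
  have yP p : p \in P' -> Y p /\ y <= p.2.
    move=> pP'; split; last by apply: meets_le; rewrite mem_cat pP'.
    by apply: PY; move: pP'; rewrite mem_filter => /andP[].
  apply: box_sets_joins => //; have [Yp0 yp0] := yP _ p0P'.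
  by case: (p0) Yp0 yp0 => ? ? Yp0 /= yp0; apply: box_sets_le Yp0 _ yp0.
have Zzy : Z (z, y).
  have yQ q : q \in Q' -> Z q /\ y <= q.2.
    move=> qQ'; split; last by apply: meets_le; rewrite mem_cat qQ' orbT.
    by apply: QZ; move: qQ'; rewrite mem_filter => /andP[].
  apply: box_sets_joins => //; have [Zq0 yq0] := yQ _ q0Q'.
  by case: (q0) Zq0 yq0 => ? ? Zq0 /= yq0; apply: box_sets_le Zq0 _ yq0.
(* With [joins_bound], this makes the join of [a] with the outside first coordinates the least [a']
   above [a] for which the box of [a'] and [b] contains [R]. As [P] and [Q] lie in the same such
   boxes, [xz] follows. *)
have bound R r0 : all (inbox (a `|` joins fst r0.1 (filter out R)) b) R.
  apply/allP => r rR; have [|rout] := boolP (inbox a b r).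
    by apply: inbox_le; rewrite ?leUl.
  apply/orP; left; apply: le_trans (leUr _ _); apply: joins_ge.
  by rewrite mem_filter rR andbT.
have joins_bound R r0 w : r0 \in filter out R -> all (inbox (a `|` w) b) R ->
    joins fst r0.1 (filter out R) <= a `|` w.
  move=> r0R /allP Rw.
  have Rw1 r : r \in filter out R -> r.1 <= a `|` w.
    by rewrite mem_filter => /andP[/norP[_ /negbTE rb] /Rw]; rewrite /inbox rb orbF.
  by apply: joins_le => //; exact: Rw1.
have xz : a `|` x = a `|` z.
  apply/le_anti; rewrite !leUx !leUl /=; apply/andP; split.
    by apply: joins_bound => //; rewrite PQ ?leUl // bound.
  by apply: joins_bound => //; rewrite -PQ ?leUl // bound.
have : box a b (x `&` z, y).
  apply: YZ; split.
    by apply: box_sets_le Yxy _ _; rewrite ?leIl.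
  by apply: box_sets_le Zzy _ _; rewrite ?leIr.
case=> /= [xza|yb]; last by rewrite yb in yNb.
(* If [x ∧ z] is below [a], semidistributivity gives [a ∨ x = a], so the first coordinate of [p0] is
   below [a]. *)
case/negP: p0ab; apply/orP; left.
apply: (le_trans (joins_ge fst p0.1 p0P')); rewrite -/x.
by have := hA _ _ _ xz; rewrite [RHS](join_idPl xza) => <-; rewrite leUr.
Qed.

Lemma box_sets_box a b : box_sets (box a b).
Proof.
exists 1%N, (fun=> a), (fun=> b); split=> //.
by apply/seteqP; split=> p; [move=> pab i _|move/(_ ord0); apply].
Qed.

Lemma box_sets_core (hA : join_semidistributive A)
    (hB : join_semidistributive B) Y Z a b :
  box_sets Y -> box_sets Z ->
  (forall a' b', a <= a' -> b <= b' ->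
     (Y `<=` box a' b' <-> Z `<=` box a' b')%classic) ->
  (Y `&` Z `<=` box a b)%classic ->
  (Y `<=` box a b)%classic.
Proof.
move=> YB ZB YZ YZab.
have [uY [vY finY]] := box_sets_finite_test YB.
have [uZ [vZ finZ]] := box_sets_finite_test ZB.
move=> p0 Yp0; apply: contrapT => /inboxP/norP[p0a p0b].
(* Including the coordinates of [p0], which lies outside the box, keeps [u] and [v] from being below
   [a] and [b]; the other terms reach the thresholds of both tests. *)
pose u := p0.1 `|` (uY `|` uZ); pose v := p0.2 `|` (vY `|` vZ).
have ua : ~~ (u <= a) by rewrite leUx negb_and p0a.
have vb : ~~ (v <= b) by rewrite leUx negb_and p0b.
have [||P [HP testP]] := finY u v; try by rewrite !lexU2 ?lexx ?orbT.
have [||Q [HQ testQ]] := finZ u v; try by rewrite !lexU2 ?lexx ?orbT.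
(* A box with [u <= a'] or [v <= b'] contains every point bounded by [u] and [v]; for any other box
   the finite test applies. *)
have transfer a' b' Y' Z' P' Q' :
    (forall p, p \in P' -> [/\ Y' p, p.1 <= u & p.2 <= v]) ->
    (forall a b, ~~ (u <= a) -> ~~ (v <= b) ->
       all (inbox a b) Q' -> (Z' `<=` box a b)%classic) ->
    (Z' `<=` box a' b' -> Y' `<=` box a' b')%classic ->
    all (inbox a' b') Q' -> all (inbox a' b') P'.
  move=> HP' testQ' ZY' Q'in; apply/allP => p /HP'[Yp pu pv].
  have [ua'|ua'] := boolP (u <= a'); first by rewrite /inbox (le_trans pu ua').
  have [vb'|vb'] := boolP (v <= b').
    by rewrite /inbox (le_trans pv vb') orbT.
  by apply/inboxP; apply: ZY' Yp; apply: testQ'.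
have Pab : all (inbox a b) P.
  apply: (box_sets_finite_core hA hB YB ZB) => [p /HP[]|q /HQ[]|a' b' aa bb|] //.
  have [YZab' ZYab'] := YZ a' b' aa bb; apply/idP/idP.
    exact: transfer HQ testP YZab'.
  exact: transfer HP testQ ZYab'.
by have /inboxP/orP[] := testP _ _ ua vb Pab _ Yp0; apply/negP.
Qed.

End BoxSets.

Theorem corollary8p2 (dA dB : Order.disp_t)
    (A : latticeType dA) (B : latticeType dB)
    (hA : join_semidistributive A) (hB : join_semidistributive B) :
  join_semidistributive (box_product A B).
Proof.
move=> X Y Z XYZ; apply/le_anti/andP; split; last by rewrite leU2 ?leIl.
rewrite leUx leUl /=.
set J := X `|` (Y `&` Z); have [n [a [b [_ JE]]]] := box_productP J.
apply/box_product_leP => p Yp; rewrite JE => i _; move: p Yp.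
(* As [K] contains [X], containing [Y] amounts to containing [X ∨ Y], which equals [X ∨ Z]. *)
have JK (K : box_product A B) : J <= K -> (Y <= K) = (Z <= K).
  rewrite leUx => /andP[XK _].
  by have := leUx X Y K; rewrite XYZ leUx XK.
have Jab : (J `<=` box (a i) (b i))%classic by rewrite JE => p; apply.
apply: (box_sets_core hA hB (box_productP Y) (box_productP Z)).
  move=> a' b' aa bb.
  pose K : box_product A B := BoxProduct (mem_set (box_sets_box a' b')).
  have JleK : J <= K.
    apply/box_product_leP => p /Jab/inboxP pab.
    by apply/inboxP; apply: inbox_le pab.
  have YK : (Y <= K) <-> (Y `<=` box a' b')%classic.
    by split=> /(box_product_leP Y K).
  have ZK : (Z <= K) <-> (Z `<=` box a' b')%classic.
    by split=> /(box_product_leP Z K).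
  by rewrite -YK -ZK JK.
move=> p Yzp; apply: Jab; move: p Yzp.
by apply/(@box_product_leP _ _ _ _ (Y `&` Z)); exact: leUr.
Qed.
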